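(* For any finite graph $G$ there exist connected finite graphs with automorphism group $\operatorname{Aut}(G)$ and arbitrarily large clique number. That is, for every finite graph $G$ and every positive integer $k$ there exists a connected finite graph $H$ with $\operatorname{Aut}(H)\cong\operatorname{Aut}(G)$ and clique number $\omega(H)\geq k$.
   Context: Graphs are simple and undirected. $\operatorname{Aut}(G)$ denotes the group of graph automorphisms of $G$, and $\cong$ denotes isomorphism of groups. The clique number $\omega(H)$ is the largest number of vertices in a set of pairwise adjacent vertices of $H$. *)

(* Defs.v *)
From HB Require Import structures.
From mathcomp Require Import all_boot all_fingroup.

Set Implicit Arguments.
Unset Strict Implicit.
Unset Printing Implicit Defensive.

(* Finite simple undirected graphs; the vertex set may be empty. *)
Record sgraph := SGraph {
  vertex :> finType;
  adj : rel vertex;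
  adj_sym : symmetric adj;
  adj_irr : irreflexive adj
}.

Definition graph_aut (G : sgraph) : {set {perm G}} :=
  [set s : {perm G} | [forall x, forall y, adj (s x) (s y) == adj x y]].

Lemma graph_autP (G : sgraph) (s : {perm G}) :
  reflect (forall x y, adj (s x) (s y) = adj x y) (s \in graph_aut G).
Proof.
rewrite inE; apply: (iffP forallP) => [sP x y|sP x].
  by have /forallP/(_ y)/eqP := sP x.
by apply/forallP => y; rewrite sP.
Qed.

Lemma graph_aut_group_set (G : sgraph) : group_set (graph_aut G).
Proof.
apply/group_setP; split=> [|s t /graph_autP sP /graph_autP tP].
  by apply/graph_autP => x y; rewrite !perm1.
by apply/graph_autP => x y; rewrite !permM tP sP.
Qed.

Canonical graph_aut_group (G : sgraph) : {group {perm G}} :=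
  Group (graph_aut_group_set G).

(* The graph with no vertices is not counted as connected. *)
Definition connected_graph (G : sgraph) : Prop :=
  0 < #|G| /\ forall x y : G, connect (@adj G) x y.

Definition clique (G : sgraph) (A : {set G}) : bool :=
  [forall x in A, forall y in A, (x != y) ==> adj x y].

Definition clique_number (G : sgraph) : nat :=
  \max_(A : {set G} | clique A) #|A|.

(* Main.v *)
Require Import Defs.
From HB Require Import structures.
From mathcomp Require Import all_boot all_fingroup.

(** If no vertex of a graph is adjacent to all the others, then in the cone over
    it the apex is the only such vertex, so adding the apex does not change the
    automorphism group; neither does complementation.  The complement of a cone
    over a nonempty graph again has no dominating vertex, so "cone, then
    complement" can be iterated; every two rounds add one vertex to the largest
    clique, and a last cone makes the graph connected.  To start, a graph with
    at least two vertices cannot have both a dominating and an isolated vertex,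
    so it or its complement is a valid seed; a graph with at most one vertex is
    replaced by an asymmetric graph on six vertices. *)

Set Implicit Arguments.
Unset Strict Implicit.
Unset Printing Implicit Defensive.

(** This holds vacuously for the empty graph and fails for a single vertex; hence nonemptiness of
    the seed is recorded separately. *)
Definition undominated (G : sgraph) : Prop :=
  forall x : G, exists2 y : G, y != x & ~~ adj x y.

Lemma clique_number_ge (G : sgraph) (A : {set G}) :
  clique A -> #|A| <= clique_number G.
Proof. exact: (@leq_bigmax_cond _ _ (fun A : {set G} => #|A|)). Qed.

Lemma clique_number_attained (G : sgraph) :
  exists2 A : {set G}, clique A & #|A| = clique_number G.
Proof.
have P0 : 0 < #|[pred A : {set G} | clique A]|.
  by apply/card_gt0P; exists set0; rewrite inE; apply/forall_inP=> x; rewrite inE.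
have [A clA maxA] := eq_bigmax_cond (fun A : {set G} => #|A|) P0.
by exists A; rewrite // -maxA.
Qed.

Lemma cliqueP (G : sgraph) (A : {set G}) :
  reflect {in A &, forall x y, x != y -> adj x y} (clique A).
Proof.
apply: (iffP forall_inP) => [clA x y Ax Ay|clA x Ax].
  by move/forall_inP: (clA x Ax) => /(_ y Ay)/implyP.
by apply/forall_inP=> y Ay; apply/implyP; apply: clA.
Qed.

Section Complement.
Variable G : sgraph.

Definition compl_adj : rel G := fun x y => (x != y) && ~~ adj x y.

Lemma compl_adj_sym : symmetric compl_adj.
Proof. by move=> x y; rewrite /compl_adj eq_sym adj_sym. Qed.

Lemma compl_adj_irr : irreflexive compl_adj.
Proof. by move=> x; rewrite /compl_adj eqxx. Qed.

Definition compl : sgraph := SGraph compl_adj_sym compl_adj_irr.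

Lemma graph_aut_compl : graph_aut compl = graph_aut G.
Proof.
apply/setP=> s; apply/(@graph_autP compl s)/(@graph_autP G s) => sP x y; last first.
  by rewrite /= /compl_adj sP (inj_eq perm_inj).
have := sP x y; rewrite /= /compl_adj (inj_eq perm_inj).
(* Off the diagonal the complement determines [adj]; on it both sides are false. *)
by case: eqVneq => [->|_ /negb_inj //]; rewrite !adj_irr.
Qed.

Lemma undominated_or_compl : 1 < #|G| -> undominated G \/ undominated compl.
Proof.
move=> G_gt1.
have [/existsP[d /forallP dP]|] :=
  boolP [exists x : G, forall y : G, (y != x) ==> adj x y]; last first.
  rewrite negb_exists => /forallP noD; left => x.
  have := noD x; rewrite negb_forall => /existsP[y].
  by rewrite negb_imply => /andP[yx nxy]; exists y.
(* The dominating vertex [d] is isolated in the complement, so it is the witness for every other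
   vertex, and any second vertex is the witness for [d]. *)
right=> x; have [->|xd] := eqVneq x d; last first.
  exists d; first by rewrite eq_sym.
  by rewrite /= /compl_adj adj_sym (implyP (dP x) xd) andbF.
have [y yd] : exists y : G, y != d.
  have /card_gt0P[y] : 0 < #|predC1 d|.
    by have := cardC1 d => ->; rewrite -ltnS prednK // ltnW.
  by rewrite inE; exists y.
by exists y; rewrite //= /compl_adj (implyP (dP y) yd) andbF.
Qed.

End Complement.

Section Cone.
Variable G : sgraph.

Definition cone_adj (u v : option G) : bool :=
  match u, v with
  | Some x, Some y => adj x y
  | None, None => false
  | _, _ => true
  end.

Lemma cone_adj_sym : symmetric cone_adj.
Proof. by case=> [x|] [y|] //=; rewrite adj_sym. Qed.

Lemma cone_adj_irr : irreflexive cone_adj.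
Proof. by case=> [x|] //=; rewrite adj_irr. Qed.

Definition cone : sgraph := SGraph cone_adj_sym cone_adj_irr.

Lemma cone_connected : connected_graph cone.
Proof.
split=> [|x y]; first by apply/card_gt0P; exists None.
have to_apex z : connect (@adj cone) z None.
  by case: z => [z|]; [apply: connect1 | apply: connect0].
apply: connect_trans (to_apex x) _.
by case: y => [y|]; [apply: connect1 | apply: connect0].
Qed.

(** In the complement the apex is isolated, so it serves every old vertex, and any old vertex serves
    the apex. *)
Lemma compl_cone_undominated : 0 < #|G| -> undominated (compl cone).
Proof. by case/card_gt0P=> g _ [x|]; [exists None | exists (Some g)]. Qed.

Lemma clique_number_cone : clique_number G < clique_number cone.
Proof.
have [A /cliqueP clA <-] := clique_number_attained G.
have -> : #|A|.+1 = #|None |: Some @: A|.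
  rewrite cardsU1 (card_imset _ Some_inj).
  by have -> : None \notin Some @: A by apply/imsetP; case.
apply: (@clique_number_ge cone); apply/cliqueP.
by move=> x y /setU1P[->|/imsetP[a Aa ->]] /setU1P[->|/imsetP[b Ab ->]] //=;
  apply: clA.
Qed.

Lemma omap_perm_inj (s : {perm G}) : injective (omap s).
Proof. by move=> [x|] [y|] //= [] /perm_inj ->. Qed.

Definition cone_perm (s : {perm G}) : {perm cone} := perm (@omap_perm_inj s).

Lemma cone_permM :
  {in graph_aut G &, {morph cone_perm : s t / (s * t)%g}}.
Proof. by move=> s t _ _; apply/permP=> -[x|]; rewrite !permE //= !permE. Qed.

Canonical cone_perm_morphism := Morphism cone_permM.

Lemma cone_perm_inj : injective cone_perm.
Proof.
move=> s t /permP st; apply/permP=> x.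
by have := st (Some x); rewrite !permE => -[].
Qed.

Lemma graph_aut_apex (t : {perm cone}) :
  undominated G -> t \in graph_aut cone -> t None = None.
Proof.
move=> undG /graph_autP tP; case tN: (t None) => [x|] //.
have [y yx nxy] := undG x.
(* The preimage of [Some y] is not adjacent to the apex, so it is the apex itself, which forces
   [y = x]. *)
have := tP None ((t^-1)%g (Some y)); rewrite permKV tN /= (negbTE nxy).
case E: ((t^-1)%g (Some y)) => [z|] //= _.
by move: yx; have := congr1 t E; rewrite permKV tN => -[->]; rewrite eqxx.
Qed.

(** Extending by a fixed apex is an injective morphism; it is onto because every automorphism of the
    cone fixes the apex and so restricts to [G]. *)
Lemma graph_aut_cone :
  undominated G -> isog (graph_aut cone) (graph_aut G).
Proof.
move=> undG; rewrite isog_sym; apply/isogP; exists cone_perm_morphism.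
  by apply/injmP=> s t _ _; apply: cone_perm_inj.
apply/setP=> t; rewrite morphimEdom; apply/imsetP/idP => [[s /graph_autP sP ->]|tA].
  by apply/graph_autP=> -[x|] [y|]; rewrite !permE //=.
have tN := graph_aut_apex undG tA.
(* The default is never taken: [t] is injective and already sends [None] to [None]. *)
pose f (x : G) : G := odflt x (t (Some x)).
have fE x : t (Some x) = Some (f x).
  by rewrite /f; case E: (t (Some x)) => [//|]; have := perm_inj (etrans E (esym tN)).
have f_inj : injective f.
  by move=> x y fxy; have /perm_inj[] : t (Some x) = t (Some y) by rewrite !fE fxy.
exists (perm f_inj).
  apply/graph_autP=> x y; rewrite !permE.
  by have /graph_autP/(_ (Some x) (Some y)) := tA; rewrite !fE.
by apply/permP=> -[x|]; rewrite permE /= ?permE.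
Qed.

End Cone.

(* [compl (cone (compl G))] is [G] with an isolated vertex added. *)
Lemma clique_number_add_isolated (G : sgraph) :
  clique_number G <= clique_number (compl (cone (compl G))).
Proof.
have [A /cliqueP clA <-] := clique_number_attained G.
rewrite -(card_imset _ Some_inj).
apply: (@clique_number_ge (compl (cone (compl G)))); apply/cliqueP.
move=> _ _ /imsetP[a Aa ->] /imsetP[b Ab ->] ab.
by rewrite /= /compl_adj ab /= /compl_adj negb_and !negbK clA ?orbT.
Qed.

Lemma graph_aut_compl_cone (G : sgraph) :
  undominated G -> isog (graph_aut (compl (cone G))) (graph_aut G).
Proof. by rewrite graph_aut_compl; apply: graph_aut_cone. Qed.

Lemma card_compl_cone (G : sgraph) : 0 < #|compl (cone G)|.
Proof. by apply/card_gt0P; exists None. Qed.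

Lemma undominated_large_clique (G : sgraph) (k : nat) :
    0 < #|G| -> undominated G ->
  exists H : sgraph,
    [/\ undominated H, isog (graph_aut H) (graph_aut G), 0 < #|H|
      & k <= clique_number H].
Proof.
move=> G0 undG; elim: k => [|k [H [undH HG H0 kH]]].
  by exists G; split; rewrite ?isog_refl.
have undH1 := compl_cone_undominated H0.
(* This is [cone H] plus an isolated vertex: the apex enlarges the clique, and the isolated vertex
   keeps the apex from dominating. *)
exists (compl (cone (compl (cone H)))); split.
- exact/compl_cone_undominated/card_compl_cone.
- apply: isog_trans (graph_aut_compl_cone undH1) _.
  exact: isog_trans (graph_aut_compl_cone undH) HG.
- exact: card_compl_cone.
- apply: leq_trans (clique_number_add_isolated (cone H)).
  exact: leq_ltn_trans kH (clique_number_cone H).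
Qed.

(** The triangle 1, 2, 5 with a tail of length one at 1 and a tail of length two at 2. *)
Definition asym_edges : seq (nat * nat) :=
  [:: (0, 1); (1, 2); (2, 3); (3, 4); (1, 5); (2, 5)].

Definition asym_rel (i j : nat) : bool :=
  ((i, j) \in asym_edges) || ((j, i) \in asym_edges).

Definition asym_adj : rel 'I_6 := fun i j => asym_rel i j.

Lemma asym_adj_sym : symmetric asym_adj.
Proof. by move=> i j; rewrite /asym_adj /asym_rel orbC. Qed.

Lemma asym_adj_irr : irreflexive asym_adj.
Proof. by case; do 6?[case=> //]. Qed.

Definition asym_graph : sgraph := SGraph asym_adj_sym asym_adj_irr.

(** Stated over [nat] rather than ['I_6] so that the finite check is a plain computation on
    lists. *)
Lemma asym_rel_rigid (f : nat -> nat) :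
    (forall i, i < 6 -> f i < 6) ->
    uniq (map f (iota 0 6)) ->
    (forall i j, i < 6 -> j < 6 -> asym_rel i j -> asym_rel (f i) (f j)) ->
  map f (iota 0 6) = iota 0 6.
Proof.
move=> f6 f_uniq f_adj.
pose I := iota 0 6.
(* Here [a], [b], [c], [d], [e], [g] range over the possible images of 0, 1, 2, 3, 4, 5, with one
   premise per edge. *)
have search : all (fun a => all (fun b => asym_rel a b ==>
    all (fun c => asym_rel b c ==> all (fun d => asym_rel c d ==>
    all (fun e => asym_rel d e ==> all (fun g => asym_rel b g ==>
      asym_rel c g ==> uniq [:: a; b; c; d; e; g] ==>
      ([:: a; b; c; d; e; g] == I)) I) I) I) I) I) I by vm_compute.
have fI i : i < 6 -> f i \in I by move=> /f6; rewrite mem_iota.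
move/allP: search => /(_ _ (fI 0 isT)).
move/allP/(_ _ (fI 1 isT))/implyP/(_ (f_adj 0 1 isT isT isT)).
move/allP/(_ _ (fI 2 isT))/implyP/(_ (f_adj 1 2 isT isT isT)).
move/allP/(_ _ (fI 3 isT))/implyP/(_ (f_adj 2 3 isT isT isT)).
move/allP/(_ _ (fI 4 isT))/implyP/(_ (f_adj 3 4 isT isT isT)).
move/allP/(_ _ (fI 5 isT))/implyP/(_ (f_adj 1 5 isT isT isT)).
by move/implyP/(_ (f_adj 2 5 isT isT isT))/implyP/(_ f_uniq)/eqP.
Qed.

Lemma graph_aut_asym : graph_aut asym_graph = 1%g.
Proof.
apply/trivgP/subsetP=> s /graph_autP sP; rewrite inE; apply/eqP/permP=> x.
pose f i : nat := s (inord i : 'I_6).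
have fE : map f (iota 0 6) = iota 0 6.
  apply: asym_rel_rigid => [i _||i j i6 j6 ij]; first exact: ltn_ord.
    rewrite map_inj_in_uniq ?iota_uniq // => i j; rewrite !mem_iota => i6 j6.
    by move=> /val_inj/perm_inj/(congr1 val); rewrite /= !inordK.
  by have := sP (inord i) (inord j); rewrite /= /asym_adj !inordK // => ->.
apply: val_inj; rewrite perm1 /=.
have := congr1 (nth 0 ^~ x) fE.
by rewrite (nth_map 0) ?size_iota // nth_iota // add0n /f inord_val.
Qed.

Lemma asym_undominated : undominated asym_graph.
Proof.
(* The only neighbour of 4 is 3, and the only neighbour of 0 is 1. *)
move=> x; exists (if x <= 1 then Ordinal (isT : 4 < 6) else ord0);
  by case: x; do 6?[case=> //].
Qed.

Theorem corollary2 (G : sgraph) (k : nat) (hk : 0 < k) :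
  exists H : sgraph,
    [/\ connected_graph H,
        isog (graph_aut H) (graph_aut G)
      & k <= clique_number H].
Proof.
have [S [S0 undS SG]] : exists S : sgraph,
    [/\ 0 < #|S|, undominated S & isog (graph_aut S) (graph_aut G)].
  have [G_le1|G_gt1] := leqP #|G| 1.
    exists asym_graph; split; first by rewrite card_ord.
      exact: asym_undominated.
    (* On at most one vertex the identity is the only permutation, so both groups are trivial. *)
    apply: trivial_isog; first exact: graph_aut_asym.
    apply/trivgP/subsetP=> s _; rewrite inE; apply/eqP/permP=> x.
    exact: (card_le1_eqP G_le1).
  have G_gt0 := ltnW G_gt1.
  have [undG|undG] := undominated_or_compl G_gt1.
    by exists G; split=> //; apply: isog_refl.
  exists (compl G); split=> //; rewrite graph_aut_compl.
  exact: (isog_refl (graph_aut_group G)).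
have [H [undH HS _ kH]] := undominated_large_clique k S0 undS.
exists (cone H); split; first exact: cone_connected.
  exact: isog_trans (graph_aut_cone undH) (isog_trans HS SG).
exact: ltnW (leq_ltn_trans kH (clique_number_cone H)).
Qed.
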